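(* Let $M\in\mathbb{R}_{>0}^{\mathbb{N}}$ and $\Phi\in\mathbb{R}_{\ge 0}^{\mathbb{N}}$, and for $c>0$ put $M^{(c,\Phi)}_j:=c^{\Phi_j}M_j$, $j\in\mathbb{N}$. (i) (Roumieu case) Assume that $M^{(c,\Phi)}$ is log-convex and normalized for some $c\ge 1$. Let $\mathcal{L}=\{L^{(x)}:x>0\}$ be a weight matrix all of whose sequences are normalized and log-convex (in particular, $\mathcal{L}$ may be any standard log-convex matrix). If $\mathcal{E}_{\{M,\Phi\}}(\mathbb{R})=\mathcal{E}_{\{\mathcal{L}\}}(\mathbb{R})$ as sets, then $\liminf_{j\to\infty}\Phi_j/j>0$. (ii) (Beurling case) Assume that for every $c>0$ one has $\lim_{j\to\infty}(M^{(c,\Phi)}_j)^{1/j}=+\infty$ and that, after possibly changing finitely many of its terms, $M^{(c,\Phi)}$ is log-convex with value $1$ at $j=0$. Let $\mathcal{L}=\{L^{(x)}:x>0\}$ be a standard log-convex weight matrix. If $\mathcal{E}_{(M,\Phi)}(\mathbb{R})=\mathcal{E}_{(\mathcal{L})}(\mathbb{R})$ as sets (and thus automatically as Fréchet spaces), then $\liminf_{j\to\infty}\Phi_j/j>0$.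
   Context: $\mathbb{N}=\{0,1,2,\dots\}$. A sequence $N\in\mathbb{R}_{>0}^{\mathbb{N}}$ is normalized if $1=N_0\le N_1$, and log-convex if $N_j^2\le N_{j-1}N_{j+1}$ for all $j\ge 1$. $\mathcal{LC}$ is the set of normalized log-convex $N$ with $\lim_{j\to\infty}(N_j)^{1/j}=\infty$. A weight matrix is a family $\mathcal{L}=\{L^{(x)}\in\mathbb{R}_{>0}^{\mathbb{N}}:x>0\}$ with $L^{(x)}_j\le L^{(y)}_j$ for all $j$ whenever $x\le y$; it is standard log-convex if every $L^{(x)}\in\mathcal{LC}$. $\mathcal{E}(\mathbb{R})$ denotes the smooth complex-valued functions on $\mathbb{R}$. For compact $K\subset\mathbb{R}$ and $h>0$ put $\|f\|_{M,\Phi,K,h}:=\sup_{j\in\mathbb{N},x\in K}\frac{|f^{(j)}(x)|}{h^{\Phi_j}M_j}$ and $\|f\|_{M,K,h}:=\sup_{j\in\mathbb{N},x\in K}\frac{|f^{(j)}(x)|}{h^{j}M_j}$. Then - $\mathcal{E}_{\{M,\Phi\}}(\mathbb{R})$ (resp. $\mathcal{E}_{(M,\Phi)}(\mathbb{R})$): all $f\in\mathcal{E}(\mathbb{R})$ such that for every compact $K$ and some (resp. every) $h>0$, $\|f\|_{M,\Phi,K,h}<\infty$; - $\mathcal{E}_{\{\mathcal{L}\}}(\mathbb{R})$ (resp. $\mathcal{E}_{(\mathcal{L})}(\mathbb{R})$): all $f\in\mathcal{E}(\mathbb{R})$ such that for every compact $K$ there exist $x,h>0$ with (resp. for all $x,h>0$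 one has) $\|f\|_{L^{(x)},K,h}<\infty$. The Beurling classes carry the Fréchet topology given by all the respective seminorms. *)

(* Defs.v *)
From Stdlib Require Import Reals List.
From Coquelicot Require Import Coquelicot.
Open Scope R_scope.

Definition positive_seq (N : nat -> R) : Prop := forall j, 0 < N j.

Definition normalized (N : nat -> R) : Prop := 1 = N 0%nat /\ N 0%nat <= N 1%nat.

Definition log_convex (N : nat -> R) : Prop :=
  forall j, (1 <= j)%nat -> N j ^ 2 <= N (j - 1)%nat * N (j + 1)%nat.

(* The term [j = 0], where [/ INR 0] is a junk value, does not affect the limit. *)
Definition root_to_infinity (N : nat -> R) : Prop :=
  is_lim_seq (fun j => Rpower (N j) (/ INR j)) p_infty.

Definition LC (N : nat -> R) : Prop :=
  positive_seq N /\ normalized N /\ log_convex N /\ root_to_infinity N.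

(* Only the sequences [L x] with [0 < x] belong to the matrix. *)
Definition weight_matrix (L : R -> nat -> R) : Prop :=
  (forall x, 0 < x -> positive_seq (L x)) /\
  (forall x y, 0 < x -> x <= y -> forall j, L x j <= L y j).

Definition standard_log_convex (L : R -> nat -> R) : Prop :=
  weight_matrix L /\ forall x, 0 < x -> LC (L x).

(* M^{(c,Phi)}_j = c^{Phi_j} M_j, for [0 < c]. *)
Definition Mc (M Phi : nat -> R) (c : R) (j : nat) : R := Rpower c (Phi j) * M j.

(* A complex-valued function of a real variable is differentiated componentwise. *)
Definition smooth (f : R -> C) : Prop :=
  forall (j : nat) (x : R),
    ex_derive_n (fun t => Re (f t)) j x /\ ex_derive_n (fun t => Im (f t)) j x.

Definition CDerive_n (f : R -> C) (j : nat) (x : R) : C :=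
  (Derive_n (fun t => Re (f t)) j x, Derive_n (fun t => Im (f t)) j x).

(* sup_{j, x in K} |f^{(j)}(x)| / W_j in [0, +oo]; the value 0 is adjoined to the
   set so that the supremum over an empty [K] is 0 rather than [m_infty]. *)
Definition sup_norm (W : nat -> R) (K : R -> Prop) (f : R -> C) : Rbar :=
  Lub_Rbar (fun r => r = 0 \/
    exists (j : nat) (x : R), K x /\ r = Cmod (CDerive_n f j x) / W j).

Definition norm_MPhi (M Phi : nat -> R) (K : R -> Prop) (h : R) (f : R -> C) : Rbar :=
  sup_norm (Mc M Phi h) K f.

Definition norm_M (M : nat -> R) (K : R -> Prop) (h : R) (f : R -> C) : Rbar :=
  sup_norm (fun j => h ^ j * M j) K f.

Definition Roumieu_MPhi (M Phi : nat -> R) (f : R -> C) : Prop :=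
  smooth f /\ forall K, compact K ->
    exists h, 0 < h /\ Rbar_lt (norm_MPhi M Phi K h f) p_infty.

Definition Beurling_MPhi (M Phi : nat -> R) (f : R -> C) : Prop :=
  smooth f /\ forall K, compact K ->
    forall h, 0 < h -> Rbar_lt (norm_MPhi M Phi K h f) p_infty.

Definition Roumieu_mx (L : R -> nat -> R) (f : R -> C) : Prop :=
  smooth f /\ forall K, compact K ->
    exists x h, 0 < x /\ 0 < h /\ Rbar_lt (norm_M (L x) K h f) p_infty.

Definition Beurling_mx (L : R -> nat -> R) (f : R -> C) : Prop :=
  smooth f /\ forall K, compact K ->
    forall x h, 0 < x -> 0 < h -> Rbar_lt (norm_M (L x) K h f) p_infty.

Definition same_set (E F : (R -> C) -> Prop) : Prop := forall f, E f <-> F f.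

Definition seminorms_MPhi (M Phi : nat -> R) (p : (R -> C) -> Rbar) : Prop :=
  exists K h, compact K /\ 0 < h /\ p = norm_MPhi M Phi K h.

Definition seminorms_mx (L : R -> nat -> R) (p : (R -> C) -> Rbar) : Prop :=
  exists K x h, compact K /\ 0 < x /\ 0 < h /\ p = norm_M (L x) K h.

(* The open sets of the locally convex topology on [E] generated by the seminorms
   in [P]: each point of [U] has a neighbourhood in [U] cut out by finitely many of
   the seminorms. *)
Definition seminorm_open (E : (R -> C) -> Prop) (P : ((R -> C) -> Rbar) -> Prop)
    (U : (R -> C) -> Prop) : Prop :=
  (forall f, U f -> E f) /\
  forall f, U f ->
    exists (s : list ((R -> C) -> Rbar)) (eps : R), List.Forall P s /\ 0 < eps /\
      forall g, E g ->
        List.Forall (fun p => Rbar_lt (p (fun t => Cminus (g t) (f t))) eps) s -> U g.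

Definition same_Frechet_space (M Phi : nat -> R) (L : R -> nat -> R) : Prop :=
  same_set (Beurling_MPhi M Phi) (Beurling_mx L) /\
  forall U, seminorm_open (Beurling_MPhi M Phi) (seminorms_MPhi M Phi) U <->
            seminorm_open (Beurling_mx L) (seminorms_mx L) U.

(* Main.v *)
(* Dilations [f |-> f(a .)] preserve the class of a weight matrix, since its norms carry a
   factor [h ^ j]; they preserve the class of [(M, Phi)] only if [2 ^ j] is bounded by some
   [C * rho ^ Phi_j], which forces [liminf Phi_j / j > 0].

   Roumieu: with [N = M^{(c,Phi)}], a function [u] with [2^{-j} N_j <= |u^{(j)}(0)|] and
   [|u^{(j)}| <= 4 N_j] lies in the class, hence so does [u(4 .)], and comparing the
   derivatives at 0 gives [2 ^ j <= C (h / c) ^ Phi_j].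

   Beurling: the seminorms are suprema of continuous functionals, so a gliding hump argument
   gives the equality of the topologies and the continuity of the dilation by 2. Testing this
   continuity on [cos (mu x) + sin (mu x)] with [mu = N_{j+1} / N_j], [N] a log-convex
   modification of [M^{(1/(n+1),Phi)}], gives [2 ^ j <= C (n+1) ^ Phi_j]. *)

Require Import Defs.
From Stdlib Require Import Reals List Lra Lia Classical ClassicalEpsilon FunctionalExtensionality PropExtensionality.
From Coquelicot Require Import Coquelicot.
Open Scope R_scope.

(** * Smooth real functions and termwise differentiation of limits *)

Definition rsmooth (u : R -> R) : Prop := forall j x, ex_derive_n u j x.

Lemma rsmooth_lin (a b : R) (u v : R -> R) :
  rsmooth u -> rsmooth v -> rsmooth (fun t => a * u t + b * v t).
Proof.
  intros Hu Hv j x.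
  apply ex_derive_n_plus; apply filter_forall; intros y k _; apply ex_derive_n_scal_l; auto.
Qed.

Lemma Derive_n_lin (a b : R) (u v : R -> R) (j : nat) (x : R) :
  rsmooth u -> rsmooth v ->
  Derive_n (fun t => a * u t + b * v t) j x = a * Derive_n u j x + b * Derive_n v j x.
Proof.
  intros Hu Hv.
  rewrite Derive_n_plus.
  - now rewrite !Derive_n_scal_l.
  - apply filter_forall; intros y k _; apply ex_derive_n_scal_l; auto.
  - apply filter_forall; intros y k _; apply ex_derive_n_scal_l; auto.
Qed.

Lemma rsmooth_const (a : R) : rsmooth (fun _ => a).
Proof. intros j x; apply ex_derive_n_const. Qed.

Lemma Derive_n_zero (j : nat) (x : R) : Derive_n (fun _ => 0) j x = 0.
Proof. destruct j; [reflexivity | apply Derive_n_const]. Qed.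

Lemma rsmooth_dilation (a : R) (u : R -> R) : rsmooth u -> rsmooth (fun t => u (a * t)).
Proof. intros Hu j x; apply ex_derive_n_comp_scal, filter_forall; intros y k _; apply Hu. Qed.

Lemma Derive_n_dilation (a : R) (u : R -> R) (j : nat) (x : R) :
  rsmooth u -> Derive_n (fun t => u (a * t)) j x = a ^ j * Derive_n u j (a * x).
Proof. intros Hu; apply Derive_n_comp_scal, filter_forall; intros y k _; apply Hu. Qed.

(** Used to obtain smoothness and closed forms of all derivatives together, from a guessed sequence
    of successive derivatives. *)
Lemma derive_tower (u : R -> R) (G : nat -> R -> R) :
  (forall x, G 0%nat x = u x) ->
  (forall j x, is_derive (G j) x (G (S j) x)) ->
  rsmooth u /\ forall j x, Derive_n u j x = G j x.
Proof.
  intros H0 HS.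
  assert (HG : forall j x, Derive_n u j x = G j x).
  { induction j as [|j IH]; intros x; simpl.
    - now rewrite H0.
    - rewrite (Derive_ext _ (G j)) by auto; now apply is_derive_unique. }
  split; [|exact HG].
  intros [|j] x; simpl; [exact I|].
  exists (G (S j) x); apply (is_derive_ext (G j)); auto.
Qed.

Lemma pow_half_pos (n : nat) : 0 < (1 / 2) ^ n.
Proof. apply pow_lt; lra. Qed.

Lemma pow_half_le_1 (n : nat) : (1 / 2) ^ n <= 1.
Proof. induction n as [|n IH]; simpl; lra. Qed.

Lemma geometric_tail (d : nat -> R) (B : R) (n0 : nat) :
  (forall n, (n0 <= n)%nat -> Rabs (d (S n) - d n) <= B * (1 / 2) ^ n) ->
  forall m n, (n0 <= m)%nat -> (m <= n)%nat -> Rabs (d n - d m) <= 2 * B * (1 / 2) ^ m.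
Proof.
  intros H m n Hm Hmn.
  assert (HB : 0 <= B).
  { generalize (Rle_trans _ _ _ (Rabs_pos _) (H n0 (le_n _))) (pow_half_pos n0); nra. }
  (* The exact geometric sum from [m] to [n] is kept, since the weaker bound of the goal would not
     survive the induction. *)
  cut (Rabs (d n - d m) <= 2 * B * ((1 / 2) ^ m - (1 / 2) ^ n)).
  { generalize (pow_half_pos n); nra. }
  induction Hmn as [|n Hmn IH].
  - unfold Rminus; rewrite !Rplus_opp_r, Rabs_R0; lra.
  - replace (d (S n) - d m) with ((d (S n) - d n) + (d n - d m)) by ring.
    eapply Rle_trans; [apply Rabs_triang|].
    generalize (H n ltac:(lia)); simpl; lra.
Qed.

Lemma pow_half_small (B : R) (eps : posreal) :
  exists N, forall n, (N <= n)%nat -> B * (1 / 2) ^ n < eps.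
Proof.
  assert (L : is_lim_seq (fun n => B * (1 / 2) ^ n) 0).
  { replace (Finite 0) with (Rbar_mult B 0) by (simpl; f_equal; ring).
    apply is_lim_seq_scal_l, is_lim_seq_geom; rewrite Rabs_pos_eq; lra. }
  apply is_lim_seq_spec in L; destruct (L eps) as [N HN].
  exists N; intros n Hn; specialize (HN n Hn).
  rewrite Rminus_0_r in HN; eapply Rle_lt_trans; [apply Rle_abs | exact HN].
Qed.

(** Geometric increments make the derivatives of each order uniformly Cauchy on bounded sets, so
    limit and derivative commute order by order. *)
Lemma smooth_limit (s : nat -> R -> R) :
  (forall n, rsmooth (s n)) ->
  (forall j r, exists n0 B, forall n x, (n0 <= n)%nat -> Rabs x <= r ->
     Rabs (Derive_n (s (S n)) j x - Derive_n (s n) j x) <= B * (1 / 2) ^ n) ->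
  exists f, rsmooth f /\
    forall j x, is_lim_seq (fun n => Derive_n (s n) j x) (Derive_n f j x).
Proof.
  intros Hs HB.
  assert (HC : forall j r, CVU_cauchy (fun n => Derive_n (s n) j) (fun x => Rabs x < r)).
  { intros j r eps.
    destruct (HB j r) as (n0 & B & H).
    destruct (pow_half_small (2 * B) eps) as (N & HN).
    exists (max n0 N).
    assert (W : forall m n x, Rabs x < r -> (max n0 N <= m)%nat -> (m <= n)%nat ->
              Rabs (Derive_n (s n) j x - Derive_n (s m) j x) < eps).
    { intros m n x Hx Hm Hmn.
      eapply Rle_lt_trans; [|apply (HN m); lia].
      apply (geometric_tail (fun n => Derive_n (s n) j x) B n0); try lia.
      intros; apply H; [assumption | lra]. }
    intros n m x Hx Hn Hm.
    destruct (Nat.le_ge_cases m n).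
    - now apply W.
    - rewrite Rabs_minus_sym; now apply W. }
  (* The pointwise limits of the derivatives form a tower whose bottom element is the desired
     [f]. *)
  set (G := fun j x => real (Lim_seq (fun n => Derive_n (s n) j x))).
  destruct (derive_tower (G 0%nat) G) as [Hf HG].
  - reflexivity.
  - intros j x.
    (* A bounded open interval around [x] suffices, since differentiability at [x] is local. *)
    apply (CVU_Derive (fun n => Derive_n (s n) j) (fun y => Rabs y < Rabs x + 1)).
    + apply (open_ext (fun y => - (Rabs x + 1) < y /\ y < Rabs x + 1)).
      * intros y; split; intros H; [apply Rabs_def1; lra | apply Rabs_def2 in H; lra].
      * apply open_and; [apply open_gt | apply open_lt].
    + intros a b y Ha Hb Hy.
      apply Rabs_def2 in Ha; apply Rabs_def2 in Hb; apply Rabs_def1; lra.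
    + apply CVU_dom_cauchy, HC.
    + intros n y _; apply (Hs n (S j)).
    + intros n y _; apply continuity_pt_filterlim.
      apply (ex_derive_continuous (Derive_n (s n) (S j))), (Hs n (S (S j))).
    + apply CVU_dom_cauchy, (HC (S j)).
    + lra.
  - exists (G 0%nat); split; [exact Hf|].
    intros j x; rewrite HG; unfold G; apply Lim_seq_correct', ex_lim_seq_cauchy_corr.
    intros eps; destruct (HC j (Rabs x + 1) eps) as [N HN].
    exists N; intros n m Hn Hm; apply HN; auto; lra.
Qed.

(** * The test functions *)

(* Coefficients of the derivatives of [cos + sin]: the j-th derivative is
   [p cos + q sin] with [(p, q) = trig_coef j]. *)
Fixpoint trig_coef (j : nat) : R * R :=
  match j with
  | O => (1, 1)
  | S j => (snd (trig_coef j), - fst (trig_coef j))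
  end.

Lemma trig_coef_abs (j : nat) :
  Rabs (fst (trig_coef j)) = 1 /\ Rabs (snd (trig_coef j)) = 1.
Proof.
  induction j as [|j [H1 H2]]; simpl; [now rewrite Rabs_R1 | now rewrite Rabs_Ropp].
Qed.

(** A real substitute for the exponential of frequency [mu]: each derivative at 0 has modulus
    exactly [mu ^ j], whereas for the sine or the cosine alone every other one vanishes. *)
Definition wave (mu : R) (x : R) : R := cos (mu * x) + sin (mu * x).

Lemma wave_derive (mu : R) :
  rsmooth (wave mu) /\ forall j x, Derive_n (wave mu) j x =
    mu ^ j * (fst (trig_coef j) * cos (mu * x) + snd (trig_coef j) * sin (mu * x)).
Proof.
  apply derive_tower.
  - intros x; unfold wave; simpl; ring.
  - intros j x; simpl; auto_derive; [exact I | ring].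
Qed.

Lemma wave_smooth (mu : R) : rsmooth (wave mu).
Proof. apply wave_derive. Qed.

Lemma wave_bound (mu : R) (j : nat) (x : R) :
  0 <= mu -> Rabs (Derive_n (wave mu) j x) <= 2 * mu ^ j.
Proof.
  intros Hmu; rewrite (proj2 (wave_derive mu)).
  rewrite Rabs_mult, (Rabs_pos_eq (mu ^ j)) by now apply pow_le.
  rewrite Rmult_comm; apply Rmult_le_compat_r; [now apply pow_le|].
  eapply Rle_trans; [apply Rabs_triang|].
  destruct (trig_coef_abs j) as [H1 H2]; rewrite !Rabs_mult, H1, H2.
  assert (Rabs (cos (mu * x)) <= 1) by apply Rabs_le, COS_bound.
  assert (Rabs (sin (mu * x)) <= 1) by apply Rabs_le, SIN_bound.
  lra.
Qed.

Lemma wave_at_0 (mu : R) (j : nat) : Derive_n (wave mu) j 0 = mu ^ j * fst (trig_coef j).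
Proof. rewrite (proj2 (wave_derive mu)), Rmult_0_r, cos_0, sin_0; ring. Qed.

(** The quotients [nu] are nondecreasing, so [ln N] lies above the line through its points at [k]
    and [S k]. *)
Lemma log_convex_support (N : nat -> R) (j k : nat) :
  positive_seq N -> log_convex N ->
  N k * (N (S k) / N k) ^ j <= N j * (N (S k) / N k) ^ k.
Proof.
  intros HP HL.
  set (nu := fun i => N (S i) / N i).
  assert (Hpos : forall i, 0 < nu i) by (intros; apply Rdiv_lt_0_compat; apply HP).
  assert (HN : forall i, N (S i) = N i * nu i)
    by (intros i; unfold nu; field; apply Rgt_not_eq, HP).
  assert (Hmon : forall a b, (a <= b)%nat -> nu a <= nu b).
  { intros a b Hab; induction Hab as [|b Hab IH]; [lra|].
    eapply Rle_trans; [exact IH|].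
    specialize (HL (S b) ltac:(lia)).
    replace (S b - 1)%nat with b in HL by lia.
    replace (S b + 1)%nat with (S (S b)) in HL by lia.
    rewrite (HN (S b)), (HN b) in HL.
    generalize (HP b) (Hpos b) (Hpos (S b)); intros P1 P2 P3.
    apply (Rmult_le_reg_l (N b * N b * nu b)).
    - apply Rmult_lt_0_compat; [nra | assumption].
    - nra. }
  fold (nu k); set (mu := nu k) in *.
  assert (Hmu : forall i, 0 < mu ^ i) by (intros; apply pow_lt, Hpos).
  destruct (Nat.le_ge_cases k j) as [Hj|Hj].
  - induction Hj as [|j Hj IH]; [lra|].
    rewrite HN; simpl; generalize (Hmon k j Hj) (Hpos k) (HP j) (Hmu k); fold mu.
    intros; apply (Rmult_le_compat_l mu) in IH; [|lra].
    apply Rle_trans with (mu * (N j * mu ^ k)); [lra|].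
    rewrite <- Rmult_assoc; apply Rmult_le_compat_r; nra.
  (* For [j] below [k] the induction descends from [k], on the distance to [k]. *)
  - replace j with (k - (k - j))%nat by lia.
    assert (Hd : (k - j <= k)%nat) by lia.
    induction (k - j)%nat as [|d IH]; [replace (k - 0)%nat with k by lia; lra|].
    specialize (IH ltac:(lia)).
    replace (k - d)%nat with (S (k - S d)) in IH by lia.
    rewrite HN in IH; simpl in IH.
    set (i := (k - S d)%nat) in *.
    generalize (Hmon i k ltac:(lia)) (Hpos k) (HP i) (Hmu k); fold mu; intros A1 A2 A3 A4.
    apply (Rmult_le_reg_l mu); [assumption|].
    apply Rle_trans with (N i * nu i * mu ^ k); [lra|].
    rewrite <- Rmult_assoc; apply Rmult_le_compat_r; nra.
Qed.

(** * Uniform boundedness *)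

Definition deriv_bound (W : nat -> R) (r : R) (u : R -> R) (C : R) : Prop :=
  forall j x, Rabs x <= r -> Rabs (Derive_n u j x) <= C * W j.

(* [n] indexes both the weight [W n] and the interval [[-n, n]]. *)
Definition real_class (W : nat -> nat -> R) (u : R -> R) : Prop :=
  rsmooth u /\ forall n, exists C, deriv_bound (W n) (INR n) u C.

Lemma deriv_bound_lin (W : nat -> R) (r a b C D : R) (u v : R -> R) :
  rsmooth u -> rsmooth v -> deriv_bound W r u C -> deriv_bound W r v D ->
  deriv_bound W r (fun t => a * u t + b * v t) (Rabs a * C + Rabs b * D).
Proof.
  intros Hu Hv HC HD j x Hx; rewrite Derive_n_lin by assumption.
  eapply Rle_trans; [apply Rabs_triang|]; rewrite !Rabs_mult, Rmult_plus_distr_r, !Rmult_assoc.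
  apply Rplus_le_compat; apply Rmult_le_compat_l; auto using Rabs_pos.
Qed.

Lemma deriv_bound_zero (W : nat -> R) (r : R) : deriv_bound W r (fun _ => 0) 0.
Proof. intros j x _; rewrite Derive_n_zero, Rabs_R0; lra. Qed.

Lemma real_class_lin (W : nat -> nat -> R) (a b : R) (u v : R -> R) :
  real_class W u -> real_class W v -> real_class W (fun t => a * u t + b * v t).
Proof.
  intros [Hu HCu] [Hv HCv]; split; [now apply rsmooth_lin|].
  intros n; destruct (HCu n) as [C HC], (HCv n) as [D HD].
  eexists; apply deriv_bound_lin; eassumption.
Qed.

Lemma real_class_zero (W : nat -> nat -> R) : real_class W (fun _ => 0).
Proof. split; [apply rsmooth_const | intros n; exists 0; apply deriv_bound_zero]. Qed.

Lemma dependent_choice (T : Type) (P : nat -> T -> T -> Prop) (t0 : T) :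
  (forall n t, exists t', P n t t') ->
  exists s : nat -> T, s 0%nat = t0 /\ forall n, P n (s n) (s (S n)).
Proof.
  intros H.
  exists (nat_rect (fun _ => T) t0
    (fun n t => proj1_sig (constructive_indefinite_description _ (H n t)))).
  split; [reflexivity|]; intros n; simpl.
  apply (proj2_sig (constructive_indefinite_description _ _)).
Qed.

Section UniformBoundedness.

Variables (W : nat -> nat -> R) (V : nat -> R) (r : R).
Hypothesis W_pos : forall n, positive_seq (W n).
Hypothesis W_decr : forall n m j, (n <= m)%nat -> W m j <= W n j.
Hypothesis V_pos : positive_seq V.

(** The negation of a continuity estimate, after scaling: elements small for the seminorm of index
    [n] whose [V]-quotient is large somewhere on the interval of radius [r]. *)
Definition unbounded_humps : Prop :=
  forall n e B, 0 < e -> exists u, real_class W u /\ deriv_bound (W n) (INR n) u e /\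
    exists j x, Rabs x <= r /\ B * V j <= Rabs (Derive_n u j x).

(* For one of the two signs, [s + u] or [s - u] is as large at the chosen point as [u],
   by the triangle inequality; [c'] caps the later increments so that they do not spoil
   this value. *)
Lemma hump_step (n0 n : nat) (s : R -> R) (c : R) :
  unbounded_humps -> real_class W s -> 0 < c <= 1 ->
  exists s' c', real_class W s' /\ 0 < c' <= c /\
    (forall j x, Rabs x <= INR (n + n0) ->
       Rabs (Derive_n s' j x - Derive_n s j x) <= c * (1 / 2) ^ n * W (n + n0)%nat j) /\
    exists j x, Rabs x <= r /\ INR n * V j <= Rabs (Derive_n s' j x) /\ c' * W 0%nat j <= V j.
Proof.
  intros Hump Hs Hc.
  destruct (Hump (n + n0)%nat (c * (1 / 2) ^ n) (INR n)) as (u & Hu & Hb & j & x & Hx & Hj).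
  { apply Rmult_lt_0_compat; [lra | apply pow_half_pos]. }
  assert (Hsign : exists e, Rabs e = 1 /\
    INR n * V j <= Rabs (Derive_n s j x + e * Derive_n u j x)).
  (* The sign for which the two terms do not oppose each other; then the square of the sum is at
     least the square of [b]. *)
  { set (a := Derive_n s j x); set (b := Derive_n u j x) in *.
    destruct (Rle_dec 0 (a * b)) as [Hab|Hab]; [exists 1 | exists (-1)].
    - rewrite Rabs_R1; split; [reflexivity|].
      apply (Rle_trans _ _ _ Hj), Rsqr_le_abs_0; unfold Rsqr; nra.
    - split; [rewrite Rabs_left; lra|].
      apply (Rle_trans _ _ _ Hj), Rsqr_le_abs_0; unfold Rsqr; nra. }
  destruct Hsign as (e & He & Hej).
  exists (fun t => 1 * s t + e * u t), (Rmin c (V j / W 0%nat j)).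
  assert (Hq : 0 < V j / W 0%nat j) by (apply Rdiv_lt_0_compat; [apply V_pos | apply W_pos]).
  split; [now apply real_class_lin|].
  split; [split; [apply Rmin_pos; lra | apply Rmin_l]|].
  split.
  - intros i y Hy; rewrite Derive_n_lin by (apply Hs || apply Hu).
    replace (_ - _) with (e * Derive_n u i y) by ring.
    rewrite Rabs_mult, He, Rmult_1_l; now apply Hb.
  - exists j, x; rewrite Derive_n_lin, Rmult_1_l by (apply Hs || apply Hu).
    split; [assumption|]; split; [assumption|].
    apply Rle_trans with (V j / W 0%nat j * W 0%nat j).
    + apply Rmult_le_compat_r; [apply Rlt_le, W_pos | apply Rmin_r].
    + right; field; apply Rgt_not_eq, W_pos.
Qed.

(** The limit of the partial sums stays in the class because the hump of stage [n] is at most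
    [2^{-n}] in the seminorm of index [n + n0]; at the point chosen at stage [n] the later humps
    change the value by at most [2 * V j], so the height [n * V j] persists up to a constant. *)
Lemma gliding_hump :
  unbounded_humps -> exists u, real_class W u /\ forall C, ~ deriv_bound V r u C.
Proof.
  intros Hump.
  (* The shift [n0] puts the interval of radius [r] inside every interval on which increments are
     controlled. *)
  destruct (INR_unbounded r) as [n0 Hn0].
  (* The state pairs a partial sum with the cap on the next hump; the subset type carries the
     invariants through the choice. *)
  set (T := {sc : (R -> R) * R | real_class W (fst sc) /\ 0 < snd sc <= 1}).
  assert (t0 : T) by (exists (fun _ => 0, 1); split; [apply real_class_zero | simpl; lra]).
  destruct (dependent_choice T (fun n t t' =>
      let s := fst (proj1_sig t) in let c := snd (proj1_sig t) in
      let s' := fst (proj1_sig t') in let c' := snd (proj1_sig t') in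
      c' <= c /\
      (forall j x, Rabs x <= INR (n + n0) ->
         Rabs (Derive_n s' j x - Derive_n s j x) <= c * (1 / 2) ^ n * W (n + n0)%nat j) /\
      exists j x, Rabs x <= r /\ INR n * V j <= Rabs (Derive_n s' j x) /\
        c' * W 0%nat j <= V j) t0) as (t & _ & Ht).
  { intros n [[s c] [Hs Hc]].
    destruct (hump_step n0 n s c Hump Hs Hc) as (s' & c' & Hs' & Hc' & H).
    assert (Hp : real_class W (fst (s', c')) /\ 0 < snd (s', c') <= 1) by (simpl in *; split; [assumption | lra]).
    exists (exist _ (s', c') Hp); simpl; tauto. }
  set (s := fun n => fst (proj1_sig (t n))); set (c := fun n => snd (proj1_sig (t n))).
  assert (Hs : forall n, real_class W (s n)) by (intros n; apply (proj2_sig (t n))).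
  assert (Hc : forall n, 0 < c n <= 1) by (intros n; apply (proj2_sig (t n))).
  assert (Hcd : forall n m, (n <= m)%nat -> c m <= c n).
  { intros n m Hnm; induction Hnm as [|m Hnm IH]; [lra|].
    apply Rle_trans with (c m); [apply (Ht m) | exact IH]. }
  assert (Hinc : forall n j x, Rabs x <= INR (n + n0) ->
      Rabs (Derive_n (s (S n)) j x - Derive_n (s n) j x) <= c n * (1 / 2) ^ n * W (n + n0)%nat j)
    by (intros n; apply (Ht n)).
  (* For a fixed seminorm of index [k], all stages from [k] on are geometric, because the weights
     decrease with the index. *)
  assert (Hinc' : forall k n j x, (k <= n)%nat -> Rabs x <= INR k ->
      Rabs (Derive_n (s (S n)) j x - Derive_n (s n) j x) <= W k j * (1 / 2) ^ n).
  { intros k n j x Hk Hx.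
    apply Rle_trans with (1 := Hinc n j x (Rle_trans _ _ _ Hx (le_INR k (n + n0) ltac:(lia)))).
    generalize (Hc n) (pow_half_pos n) (W_decr k (n + n0) j ltac:(lia)) (W_pos (n + n0) j).
    intros; rewrite Rmult_assoc, (Rmult_comm (W k j)).
    apply Rle_trans with (1 * ((1 / 2) ^ n * W (n + n0)%nat j)).
    - apply Rmult_le_compat_r; [apply Rlt_le, Rmult_lt_0_compat|]; tauto.
    - rewrite Rmult_1_l; apply Rmult_le_compat_l; lra. }
  destruct (smooth_limit s) as (f & Hf & Hlim).
  { intros n; apply Hs. }
  { intros j R0; destruct (INR_unbounded R0) as [k Hk].
    exists k, (W k j); intros n x Hn Hx; apply Hinc'; [assumption | lra]. }
  assert (Hdist : forall m j x B, (forall n, (m <= n)%nat ->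
      Rabs (Derive_n (s (S n)) j x - Derive_n (s n) j x) <= B * (1 / 2) ^ n) ->
      Rabs (Derive_n f j x - Derive_n (s m) j x) <= 2 * B * (1 / 2) ^ m).
  { intros m j x B H.
    apply (is_lim_seq_le_loc (fun n => Rabs (Derive_n (s n) j x - Derive_n (s m) j x))
      (fun _ => 2 * B * (1 / 2) ^ m)
      (Rbar_abs (Derive_n f j x - Derive_n (s m) j x)) (2 * B * (1 / 2) ^ m)).
    - exists m; intros n Hn.
      apply (geometric_tail (fun n => Derive_n (s n) j x) B m); auto.
    - apply is_lim_seq_abs, is_lim_seq_minus'; [apply Hlim | apply is_lim_seq_const].
    - apply is_lim_seq_const. }
  exists f; split; [split; [exact Hf|]|].
  - intros k; destruct (proj2 (Hs k) k) as [C HC].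
    exists (C + 2); intros j x Hx.
    replace (Derive_n f j x)
      with (Derive_n (s k) j x + (Derive_n f j x - Derive_n (s k) j x)) by ring.
    eapply Rle_trans; [apply Rabs_triang|]; rewrite Rmult_plus_distr_r.
    apply Rplus_le_compat; [now apply HC|].
    eapply Rle_trans; [apply (Hdist k j x (W k j)); intros; now apply Hinc'|].
    generalize (W_pos k j) (pow_half_le_1 k); nra.
  - intros C HC.
    (* The height exceeds [C] by more than the loss [2 * V j] caused by the later humps. *)
    destruct (INR_unbounded (C + 2)) as [n Hn].
    destruct (Ht n) as (_ & _ & j & x & Hx & Hj & Hcj); fold (s (S n)) (c (S n)) in *.
    assert (Hd : Rabs (Derive_n f j x - Derive_n (s (S n)) j x) <= 2 * V j * (1 / 2) ^ S n).
    { apply Hdist; intros m Hm.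
      eapply Rle_trans; [apply Hinc, Rle_trans with (INR n0); [lra | apply le_INR; lia]|].
      rewrite (Rmult_comm (c m)), Rmult_assoc, (Rmult_comm (V j)).
      apply Rmult_le_compat_l; [apply Rlt_le, pow_half_pos|].
      (* Later caps are at most [c (S n)] and later weights at most [W 0], so the cap condition at
         [j] bounds every later hump by [V j]. *)
      eapply Rle_trans; [|exact Hcj].
      apply Rmult_le_compat; [apply Rlt_le, Hc | apply Rlt_le, W_pos | now apply Hcd |].
      apply W_decr; lia. }
    assert (Hh := pow_half_le_1 (S n)).
    specialize (HC j x Hx).
    generalize (Rabs_triang_inv (Derive_n (s (S n)) j x) (Derive_n f j x)).
    rewrite Rabs_minus_sym; generalize (V_pos j); nra.
Qed.

(** If no estimate held, a violating [u] scaled to size [e] would be a hump, and the gliding hump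
    would produce an element without a [V]-bound. *)
Lemma uniform_boundedness :
  (forall u, real_class W u -> exists C, deriv_bound V r u C) ->
  exists n C, forall u D, real_class W u -> 0 < D -> deriv_bound (W n) (INR n) u D -> deriv_bound V r u (C * D).
Proof.
  intros Hfin; apply NNPP; intros Hnot.
  destruct gliding_hump as (u & Hu & HC).
  - intros n e B He; apply NNPP; intros Hno.
    apply Hnot; exists n, (B / e); intros u D Hu HD Hb j x Hx.
    apply Rnot_lt_le; intros Hlt; apply Hno.
    (* The summand [0 * 0] only gives the scaled function the shape of a linear combination. *)
    exists (fun t => e / D * u t + 0 * 0).
    assert (HeD : 0 < e / D) by now apply Rdiv_lt_0_compat.
    split; [apply (real_class_lin W _ _ u (fun _ => 0)); [assumption | apply real_class_zero]|].
    split.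
    + replace (deriv_bound (W n) (INR n) _ e) with
        (deriv_bound (W n) (INR n) (fun t => e / D * u t + 0 * 0) (Rabs (e / D) * D + Rabs 0 * 0))
        by (f_equal; rewrite Rabs_pos_eq by lra; field; lra).
      apply (deriv_bound_lin _ _ _ _ _ _ u (fun _ => 0));
        [apply Hu | apply rsmooth_const | assumption | apply deriv_bound_zero].
    + exists j, x; split; [assumption|].
      rewrite (Derive_n_lin _ _ u (fun _ => 0)), Rmult_0_l, Rplus_0_r
        by (apply Hu || apply rsmooth_const).
      rewrite Rabs_mult, Rabs_pos_eq by lra.
      apply Rle_trans with (e / D * (B / e * D * V j)).
      * right; field; lra.
      * apply Rmult_le_compat_l; lra.
  - destruct (Hfin u Hu) as [C HC']; now apply (HC C).
Qed.

End UniformBoundedness.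

(** * Classes defined by all weights of a family *)

Lemma sup_norm_lt (W : nat -> R) (K : R -> Prop) (f : R -> C) (d : R) :
  positive_seq W -> Rbar_lt (sup_norm W K f) d ->
  forall j x, K x -> Cmod (CDerive_n f j x) <= d * W j.
Proof.
  intros HW Hd j x Hx.
  assert (Hub := proj1 (Lub_Rbar_correct (fun r => r = 0 \/
    exists (j : nat) (x : R), K x /\ r = Cmod (CDerive_n f j x) / W j))).
  specialize (Hub (Cmod (CDerive_n f j x) / W j) (or_intror (ex_intro _ j (ex_intro _ x (conj Hx eq_refl))))).
  assert (H := Rbar_le_lt_trans _ _ _ Hub Hd); simpl in H.
  apply (Rmult_le_reg_r (/ W j)); [apply Rinv_0_lt_compat, HW|].
  rewrite Rmult_assoc, Rinv_r, Rmult_1_r by apply Rgt_not_eq, HW.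
  apply Rlt_le, H.
Qed.

Lemma sup_norm_le (W : nat -> R) (K : R -> Prop) (f : R -> C) (d : R) :
  positive_seq W -> 0 <= d -> (forall j x, K x -> Cmod (CDerive_n f j x) <= d * W j) ->
  Rbar_le (sup_norm W K f) d.
Proof.
  intros HW Hd H; apply Lub_Rbar_correct.
  intros y [->|(j & x & Hx & ->)]; [exact Hd|]; simpl.
  apply (Rmult_le_reg_r (W j)); [apply HW|].
  unfold Rdiv; rewrite Rmult_assoc, Rinv_l, Rmult_1_r by apply Rgt_not_eq, HW; auto.
Qed.

Lemma sup_norm_finite (W : nat -> R) (K : R -> Prop) (f : R -> C) :
  positive_seq W ->
  Rbar_lt (sup_norm W K f) p_infty <->
  exists d, 0 <= d /\ forall j x, K x -> Cmod (CDerive_n f j x) <= d * W j.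
Proof.
  intros HW; split.
  - intros H.
    (* The 0 adjoined to the set in [sup_norm] excludes the value [m_infty]. *)
    assert (H0 : Rbar_le 0 (sup_norm W K f)) by (apply Lub_Rbar_correct; now left).
    destruct (sup_norm W K f) as [d| |] eqn:E; try easy.
    exists (d + 1); split; [simpl in H0; lra|].
    apply sup_norm_lt; [assumption|]; rewrite E; simpl; lra.
  - intros (d & Hd & H).
    apply Rbar_le_lt_trans with d; [now apply sup_norm_le | exact I].
Qed.

Lemma Cmod_CDerive_n_le (f : R -> C) (j : nat) (x : R) :
  Cmod (CDerive_n f j x) <=
    Rabs (Derive_n (fun t => Re (f t)) j x) + Rabs (Derive_n (fun t => Im (f t)) j x).
Proof.
  unfold CDerive_n; set (a := Derive_n _ j x); set (b := Derive_n _ j x).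
  rewrite <- (Rabs_pos_eq (_ + _)) by (generalize (Rabs_pos a) (Rabs_pos b); lra).
  unfold Cmod; simpl; rewrite <- sqrt_Rsqr_abs; apply sqrt_le_1_alt; unfold Rsqr.
  generalize (Rabs_pos a) (Rabs_pos b) (Rsqr_abs a) (Rsqr_abs b); unfold Rsqr; nra.
Qed.

Lemma Rabs_le_Cmod_CDerive_n (f : R -> C) (j : nat) (x : R) :
  Rabs (Derive_n (fun t => Re (f t)) j x) <= Cmod (CDerive_n f j x) /\
  Rabs (Derive_n (fun t => Im (f t)) j x) <= Cmod (CDerive_n f j x).
Proof.
  generalize (Rmax_Cmod (CDerive_n f j x)); simpl; intros H.
  split; (eapply Rle_trans; [|exact H]); [apply Rmax_l | apply Rmax_r].
Qed.

Lemma compact_in_interval (K : R -> Prop) :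
  compact K -> exists r, 0 <= r /\ forall x, K x -> Rabs x <= r.
Proof.
  intros HK; destruct (compact_P1 K HK) as (a & b & Hab).
  exists (Rmax 0 (Rmax (- a) b)); split; [apply Rmax_l|].
  intros x Hx; specialize (Hab x Hx).
  generalize (Rmax_r 0 (Rmax (- a) b)) (Rmax_l (- a) b) (Rmax_r (- a) b); intros.
  apply Rabs_le; lra.
Qed.

Lemma Rabs_le_iff (x r : R) : Rabs x <= r <-> - r <= x <= r.
Proof. split; [apply Rabs_le_between | apply Rabs_le]. Qed.

Lemma deriv_bound_mono (W W' : nat -> R) (r r' : R) (u : R -> R) (C : R) :
  (forall j, W j <= W' j) -> r <= r' -> 0 <= C -> deriv_bound W r' u C -> deriv_bound W' r u C.
Proof.
  intros HW Hr HC H j x Hx.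
  apply Rle_trans with (C * W j); [apply H; lra | now apply Rmult_le_compat_l].
Qed.

Lemma deriv_bound_nonneg (W : nat -> R) (r : R) (u : R -> R) (C : R) :
  positive_seq W -> 0 <= r -> deriv_bound W r u C -> 0 <= C.
Proof.
  intros HW Hr H; specialize (H 0%nat 0); rewrite Rabs_R0 in H; specialize (H Hr).
  generalize (Rabs_pos (Derive_n u 0 0)) (HW 0%nat); nra.
Qed.

(** Both Beurling classes are of this form, with the factor [h ^ Phi_j] or [h ^ j] absorbed into the
    weights, so topological arguments are made once for a general [P]. *)
Definition weight_class (P : (nat -> R) -> Prop) (f : R -> C) : Prop :=
  smooth f /\ forall K, compact K -> forall W, P W -> Rbar_lt (sup_norm W K f) p_infty.

Definition weight_seminorms (P : (nat -> R) -> Prop) (p : (R -> C) -> Rbar) : Prop :=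
  exists K W, compact K /\ P W /\ p = sup_norm W K.

(** Together with the intervals [[-n, n]], such a decreasing cofinal sequence gives a countable
    defining system of seminorms, as the gliding hump requires. *)
Definition weight_basis (P : (nat -> R) -> Prop) (W : nat -> nat -> R) : Prop :=
  (forall V, P V -> positive_seq V) /\ (forall n, P (W n)) /\
  (forall n m j, (n <= m)%nat -> W m j <= W n j) /\
  (forall V, P V -> exists n, forall j, W n j <= V j).

Lemma weight_class_iff (P : (nat -> R) -> Prop) (W : nat -> nat -> R) (f : R -> C) :
  weight_basis P W ->
  weight_class P f <-> real_class W (fun t => Re (f t)) /\ real_class W (fun t => Im (f t)).
Proof.
  intros (Hpos & HP & Hdecr & Hcof); split.
  - intros [Hf H].
    assert (HC : forall n, exists d, forall j x, Rabs x <= INR n ->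
              Cmod (CDerive_n f j x) <= d * W n j).
    { intros n; specialize (H _ (compact_P3 (- INR n) (INR n)) _ (HP n)).
      apply sup_norm_finite in H; [|now apply Hpos].
      destruct H as (d & _ & Hd); exists d; intros j x Hx; now apply Hd, Rabs_le_iff. }
    split; (split; [intros j x; apply (Hf j x)|]); intros n; destruct (HC n) as [d Hd];
      exists d; intros j x Hx; (eapply Rle_trans; [|apply Hd, Hx]);
      apply (Rabs_le_Cmod_CDerive_n f).
  - intros [[Hr HCr] [Hi HCi]]; split; [split; [apply Hr | apply Hi]|].
    intros K HK V HV.
    destruct (compact_in_interval K HK) as (r & Hr0 & HKr).
    destruct (INR_unbounded r) as [m Hm], (Hcof V HV) as [n Hn].
    destruct (HCr (max n m)) as [c Hc], (HCi (max n m)) as [d Hd].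
    assert (Hc0 := deriv_bound_nonneg _ _ _ _ (Hpos _ (HP _)) (pos_INR _) Hc).
    assert (Hd0 := deriv_bound_nonneg _ _ _ _ (Hpos _ (HP _)) (pos_INR _) Hd).
    assert (HV' : forall j, W (max n m) j <= V j)
      by (intros j; apply Rle_trans with (W n j); [apply Hdecr; lia | apply Hn]).
    assert (Hrm : r <= INR (max n m))
      by (apply Rle_trans with (INR m); [lra | apply le_INR; lia]).
    apply sup_norm_finite; [now apply Hpos|].
    exists (c + d); split; [lra|]; intros j x Hx.
    eapply Rle_trans; [apply Cmod_CDerive_n_le|]; rewrite Rmult_plus_distr_r.
    apply Rplus_le_compat; eapply deriv_bound_mono; eauto.
Qed.

Lemma weight_class_real (P : (nat -> R) -> Prop) (W : nat -> nat -> R) (u : R -> R) :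
  weight_basis P W -> weight_class P (fun t => RtoC (u t)) <-> real_class W u.
Proof.
  intros HW; rewrite (weight_class_iff P W) by assumption; simpl.
  split; [tauto | split; [assumption | apply real_class_zero]].
Qed.

Lemma real_class_sub (W : nat -> nat -> R) (u v : R -> R) :
  real_class W u -> real_class W v -> real_class W (fun t => u t + - v t).
Proof.
  intros Hu Hv; replace (fun t => u t + - v t) with (fun t => 1 * u t + -1 * v t).
  - now apply real_class_lin.
  - apply functional_extensionality; intros t; ring.
Qed.

Lemma weight_class_sub (P : (nat -> R) -> Prop) (W : nat -> nat -> R) (f g : R -> C) :
  weight_basis P W -> weight_class P f -> weight_class P g -> weight_class P (fun t => Cminus (f t) (g t)).
Proof.
  intros HW; rewrite !(weight_class_iff P W) by assumption.
  intros [Hf1 Hf2] [Hg1 Hg2]; split; now apply real_class_sub.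
Qed.

(** An inclusion of classes is automatically continuous: a seminorm of the larger class is finite on
    each element of the smaller one, hence bounded by one seminorm there. *)
Lemma seminorm_control (P Q : (nat -> R) -> Prop) (W : nat -> nat -> R) :
  weight_basis P W -> (forall V, Q V -> positive_seq V) ->
  (forall f, weight_class P f -> weight_class Q f) ->
  forall p eps, weight_seminorms Q p -> 0 < eps ->
  exists q delta, weight_seminorms P q /\ 0 < delta /\
    forall g, weight_class P g -> Rbar_lt (q g) delta -> Rbar_lt (p g) eps.
Proof.
  intros HW HQ Hsub p eps (K & V & HK & HV & ->) Heps.
  assert (HW' := HW); destruct HW' as (Hpos & HP & Hdecr & _).
  destruct (compact_in_interval K HK) as (r & Hr0 & HKr).
  destruct (uniform_boundedness W V r) as (n & C & HC); auto.
  { intros u Hu; apply (weight_class_real P W u HW) in Hu; apply Hsub in Hu.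
    destruct Hu as [_ Hu]; specialize (Hu _ (compact_P3 (- r) r) V HV).
    apply sup_norm_finite in Hu; [|now apply HQ].
    destruct Hu as (d & _ & Hd); exists d; intros j x Hx.
    eapply Rle_trans; [apply (Rabs_le_Cmod_CDerive_n (fun t => RtoC (u t)))|].
    now apply Hd, Rabs_le_iff. }
  assert (HC1 : 0 < Rabs C + 1) by (generalize (Rabs_pos C); lra).
  (* Real and imaginary parts contribute [eps / 4] each, so the sum stays strictly below [eps];
     [Rabs C + 1] avoids a division by zero. *)
  set (delta := eps / (4 * (Rabs C + 1))).
  assert (Hdelta : 0 < delta) by (apply Rdiv_lt_0_compat; lra).
  exists (sup_norm (W n) (fun x => - INR n <= x <= INR n)), delta.
  split; [eexists _, _; split; [apply compact_P3 | split; [apply HP | reflexivity]]|].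
  split; [assumption|]; intros g Hg Hq.
  assert (Hgd : forall j x, Rabs x <= INR n -> Cmod (CDerive_n g j x) <= delta * W n j)
    by (intros j x Hx; eapply sup_norm_lt; [now apply Hpos | exact Hq | now apply Rabs_le_iff]).
  apply (weight_class_iff P W g HW) in Hg; destruct Hg as [Hgr Hgi].
  apply (HC _ delta) in Hgr; [|assumption|
    intros j x Hx; eapply Rle_trans; [apply (Rabs_le_Cmod_CDerive_n g) | now apply Hgd]].
  apply (HC _ delta) in Hgi; [|assumption|
    intros j x Hx; eapply Rle_trans; [apply (Rabs_le_Cmod_CDerive_n g) | now apply Hgd]].
  assert (Hhalf : C * delta <= eps / 4).
  { replace (eps / 4) with ((Rabs C + 1) * delta) by (unfold delta; field; lra).
    apply Rmult_le_compat_r; [lra|]; generalize (Rle_abs C); lra. }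
  apply Rbar_le_lt_trans with (eps / 2); [|simpl; lra].
  apply sup_norm_le; [now apply HQ | lra|]; intros j x Hx; apply HKr in Hx.
  eapply Rle_trans; [apply Cmod_CDerive_n_le|].
  specialize (Hgr j x Hx); specialize (Hgi j x Hx).
  generalize (HQ V HV j); nra.
Qed.

(** Each seminorm of the finite list gets one controlling seminorm, and the least radius serves for
    all. Control is applied to differences, whence the closure under subtraction. *)
Lemma seminorm_open_transfer (E F : (R -> C) -> Prop) (P Q : ((R -> C) -> Rbar) -> Prop) :
  (forall f, E f <-> F f) ->
  (forall f g, E f -> E g -> E (fun t => Cminus (f t) (g t))) ->
  (forall p eps, P p -> 0 < eps -> exists q delta, Q q /\ 0 < delta /\
     forall g, E g -> Rbar_lt (q g) delta -> Rbar_lt (p g) eps) ->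
  forall U, seminorm_open E P U -> seminorm_open F Q U.
Proof.
  intros HEF Hsub Hctl U [HU Hopen]; split; [intros f Hf; now apply HEF, HU|].
  intros f Hf; destruct (Hopen f Hf) as (s & eps & Hs & Heps & HUs).
  assert (Hlist : exists s' delta, List.Forall Q s' /\ 0 < delta /\ forall g, E g ->
    List.Forall (fun q => Rbar_lt (q g) delta) s' -> List.Forall (fun p => Rbar_lt (p g) eps) s).
  { clear HUs; induction Hs as [|p s Hp Hs (s' & d & Hs' & Hd & IH)].
    - exists nil, 1; split; [constructor|]; split; [lra | intros; constructor].
    - destruct (Hctl p eps Hp Heps) as (q & d' & Hq & Hd' & Hc).
      exists (q :: s'), (Rmin d d'); split; [now constructor|].
      split; [now apply Rmin_pos|]; intros g Hg HF; inversion_clear HF as [|? ? H1 H2].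
      constructor.
      + apply Hc; [assumption|]; apply Rbar_lt_le_trans with (1 := H1); apply Rmin_r.
      + apply IH; [assumption|]; eapply Forall_impl; [|exact H2].
        intros q' Hq'; apply Rbar_lt_le_trans with (1 := Hq'); apply Rmin_l. }
  destruct Hlist as (s' & delta & Hs' & Hd & H).
  exists s', delta; split; [assumption|]; split; [assumption|].
  intros g Hg HF; apply HUs; [now apply HEF|].
  apply H; [apply Hsub; [now apply HEF | now apply HU] | exact HF].
Qed.

Lemma same_topology (P Q : (nat -> R) -> Prop) (W X : nat -> nat -> R) :
  weight_basis P W -> weight_basis Q X -> (forall f, weight_class P f <-> weight_class Q f) ->
  forall U, seminorm_open (weight_class P) (weight_seminorms P) U <-> seminorm_open (weight_class Q) (weight_seminorms Q) U.
Proof.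
  intros HW HX Heq U; split; apply seminorm_open_transfer.
  - assumption.
  - intros f g; now apply (weight_class_sub P W).
  - intros p eps Hp Heps.
    destruct (seminorm_control Q P X HX) with (p := p) (eps := eps) as (q & d & Hq & Hd & H);
      [apply HW | apply Heq | assumption | assumption |].
    exists q, d; split; [assumption|]; split; [assumption|].
    intros g Hg; now apply H, Heq.
  - intros f; split; apply Heq.
  - intros f g; now apply (weight_class_sub Q X).
  - intros p eps Hp Heps.
    destruct (seminorm_control P Q W HW) with (p := p) (eps := eps) as (q & d & Hq & Hd & H);
      [apply HX | apply Heq | assumption | assumption |].
    exists q, d; split; [assumption|]; split; [assumption|].
    intros g Hg; now apply H, Heq.
Qed.

Lemma seminorm_open_ext (E F : (R -> C) -> Prop) (P Q : ((R -> C) -> Rbar) -> Prop) U :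
  (forall f, E f <-> F f) -> (forall p, P p <-> Q p) ->
  seminorm_open E P U <-> seminorm_open F Q U.
Proof.
  intros HEF HPQ.
  replace F with E by (apply functional_extensionality; intros f; now apply propositional_extensionality).
  replace Q with P by (apply functional_extensionality; intros p; now apply propositional_extensionality).
  reflexivity.
Qed.

(** * The two kinds of classes *)

Lemma eventually_le_le_mult (u v : nat -> R) (j0 : nat) :
  positive_seq v -> (forall j, (j0 <= j)%nat -> u j <= v j) ->
  exists C, 1 <= C /\ forall j, u j <= C * v j.
Proof.
  intros Hv H.
  assert (Hinit : exists C, 1 <= C /\ forall j, (j < j0)%nat -> u j <= C * v j).
  { clear H; induction j0 as [|k (C & HC & IH)]; [exists 1; split; [lra | lia]|].
    exists (Rmax C (u k / v k)); split; [apply Rle_trans with C; [lra | apply Rmax_l]|].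
    intros j Hj; destruct (Nat.eq_dec j k) as [->|].
    - replace (u k) with (u k / v k * v k) at 1 by (field; apply Rgt_not_eq, Hv).
      apply Rmult_le_compat_r; [apply Rlt_le, Hv | apply Rmax_r].
    - apply Rle_trans with (C * v j); [apply IH; lia|].
      apply Rmult_le_compat_r; [apply Rlt_le, Hv | apply Rmax_l]. }
  destruct Hinit as (C & HC & HCj); exists C; split; [assumption|]; intros j.
  destruct (Nat.lt_ge_cases j j0) as [Hj|Hj]; [now apply HCj|].
  specialize (H j Hj); generalize (Hv j); nra.
Qed.

(** Eventually the [j]-th root of [N j] exceeds [mu]; the finitely many other terms go into [C].
    This puts every [wave mu] into the Beurling class. *)
Lemma pow_le_of_root_to_infinity (N : nat -> R) (mu : R) :
  positive_seq N -> root_to_infinity N -> 0 < mu ->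
  exists C, 1 <= C /\ forall j, mu ^ j <= C * N j.
Proof.
  intros HN Hroot Hmu; apply is_lim_seq_spec in Hroot; destruct (Hroot mu) as [j0 Hj0].
  apply (eventually_le_le_mult _ _ (S j0)); [assumption|].
  intros j Hj; specialize (Hj0 j ltac:(lia)).
  assert (HINR : 0 < INR j) by (apply lt_0_INR; lia).
  replace (N j) with (Rpower (Rpower (N j) (/ INR j)) (INR j)).
  - rewrite <- (Rpower_pow j mu) by assumption; apply Rle_Rpower_l; lra.
  - rewrite Rpower_mult, Rinv_l, Rpower_1 by (lra || apply HN); reflexivity.
Qed.

(** Taking logarithms, [j * ln 2] is at most [ln C + a * Phi j], and the constant becomes negligible
    for large [j]. *)
Lemma LimInf_pos_of_pow_le (Phi : nat -> R) (C rho : R) (j0 : nat) :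
  (forall j, 0 <= Phi j) -> 0 < C ->
  (forall j, (j0 <= j)%nat -> 2 ^ j <= C * Rpower rho (Phi j)) ->
  Rbar_lt 0 (LimInf_seq (fun j => Phi j / INR j)).
Proof.
  intros HPhi HC H.
  set (a := Rabs (ln rho) + 1).
  assert (Ha : 0 < a) by (generalize (Rabs_pos (ln rho)); unfold a; lra).
  assert (Hln2 : 0 < ln 2) by (rewrite <- ln_1; apply ln_increasing; lra).
  assert (Hlin : forall j, (j0 <= j)%nat -> INR j * ln 2 <= ln C + Phi j * a).
  { intros j Hj; specialize (H j Hj).
    rewrite <- (Rpower_pow j 2) in H by lra; unfold Rpower in H.
    rewrite <- (exp_ln C HC), <- exp_plus in H.
    assert (INR j * ln 2 <= ln C + Phi j * ln rho) by (apply Rnot_lt_le; intros Hlt; apply exp_increasing in Hlt; lra).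
    assert (Phi j * ln rho <= Phi j * a)
      by (apply Rmult_le_compat_l; [apply HPhi | generalize (Rle_abs (ln rho)); unfold a; lra]).
    lra. }
  (* Half of the slope [ln 2 / a] is given up to absorb [ln C]. *)
  apply Rbar_lt_le_trans with (LimInf_seq (fun _ => ln 2 / (2 * a))).
  - rewrite LimInf_seq_const; simpl; apply Rdiv_lt_0_compat; lra.
  - destruct (INR_unbounded (2 * Rabs (ln C) / ln 2)) as [n Hn].
    (* Starting at [S n] rather than [n] keeps [j] positive, as the division by [INR j] requires. *)
    apply LimInf_le; exists (max (S n) j0); intros j Hj.
    specialize (Hlin j ltac:(lia)).
    assert (HINR : 0 < INR j) by (apply lt_0_INR; lia).
    assert (Hbig : 2 * Rabs (ln C) <= INR j * ln 2).
    { replace (2 * Rabs (ln C)) with (2 * Rabs (ln C) / ln 2 * ln 2) by (field; lra).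
      apply Rmult_le_compat_r; [lra|].
      apply Rle_trans with (INR n); [lra | apply le_INR; lia]. }
    apply (Rmult_le_reg_r (2 * a * INR j)); [apply Rmult_lt_0_compat; lra|].
    replace (ln 2 / (2 * a) * (2 * a * INR j)) with (INR j * ln 2) by (field; lra).
    replace (Phi j / INR j * (2 * a * INR j)) with (2 * (Phi j * a)) by (field; lra).
    generalize (Rle_abs (ln C)); lra.
Qed.

Definition weights_MPhi (M Phi : nat -> R) (V : nat -> R) : Prop :=
  exists h, 0 < h /\ V = Mc M Phi h.

Definition weights_mx (L : R -> nat -> R) (V : nat -> R) : Prop :=
  exists x h, 0 < x /\ 0 < h /\ V = fun j => h ^ j * L x j.

Definition basis_MPhi (M Phi : nat -> R) (n : nat) : nat -> R := Mc M Phi (/ INR (S n)).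

Definition basis_mx (L : R -> nat -> R) (n j : nat) : R :=
  (/ INR (S n)) ^ j * L (/ INR (S n)) j.

Lemma inv_INR_pos (n : nat) : 0 < / INR (S n).
Proof. apply Rinv_0_lt_compat, lt_0_INR; lia. Qed.

Lemma inv_INR_decr (n m : nat) : (n <= m)%nat -> / INR (S m) <= / INR (S n).
Proof. intros H; apply Rinv_le_contravar; [apply lt_0_INR; lia | apply le_INR; lia]. Qed.

Lemma inv_INR_small (h : R) : 0 < h -> exists n, / INR (S n) <= h.
Proof.
  intros Hh; destruct (INR_unbounded (/ h)) as [n Hn]; exists n.
  rewrite <- (Rinv_inv h); apply Rinv_le_contravar; [now apply Rinv_0_lt_compat|].
  apply Rle_trans with (INR n); [lra | apply le_INR; lia].
Qed.

Lemma Mc_pos (M Phi : nat -> R) (c : R) : positive_seq M -> positive_seq (Mc M Phi c).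
Proof. intros HM j; apply Rmult_lt_0_compat; [apply exp_pos | apply HM]. Qed.

Lemma Mc_mono (M Phi : nat -> R) (c d : R) (j : nat) :
  positive_seq M -> (forall j, 0 <= Phi j) -> 0 < c -> c <= d -> Mc M Phi c j <= Mc M Phi d j.
Proof.
  intros HM HPhi Hc Hcd; apply Rmult_le_compat_r; [apply Rlt_le, HM|].
  apply Rle_Rpower_l; [apply HPhi | lra].
Qed.

Lemma weight_basis_MPhi (M Phi : nat -> R) :
  positive_seq M -> (forall j, 0 <= Phi j) -> weight_basis (weights_MPhi M Phi) (basis_MPhi M Phi).
Proof.
  intros HM HPhi; split; [|split; [|split]].
  - intros V (h & Hh & ->); now apply Mc_pos.
  - intros n; exists (/ INR (S n)); split; [apply inv_INR_pos | reflexivity].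
  - intros n m j Hnm; apply Mc_mono; auto using inv_INR_pos, inv_INR_decr.
  - intros V (h & Hh & ->); destruct (inv_INR_small h Hh) as [n Hn].
    exists n; intros j; apply Mc_mono; auto using inv_INR_pos.
Qed.

Lemma pow_mul_mono (L : R -> nat -> R) (x y g h : R) (j : nat) :
  weight_matrix L -> 0 < x -> x <= y -> 0 <= g -> g <= h -> g ^ j * L x j <= h ^ j * L y j.
Proof.
  intros [Hpos Hmon] Hx Hxy Hg Hgh.
  apply Rmult_le_compat; [now apply pow_le | now apply Rlt_le, Hpos | | now apply Hmon].
  apply pow_incr; lra.
Qed.

Lemma weight_basis_mx (L : R -> nat -> R) :
  weight_matrix L -> weight_basis (weights_mx L) (basis_mx L).
Proof.
  intros HL; split; [|split; [|split]].
  - intros V (x & h & Hx & Hh & ->) j.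
    apply Rmult_lt_0_compat; [now apply pow_lt | now apply HL].
  - intros n; exists (/ INR (S n)), (/ INR (S n)); auto using inv_INR_pos.
  - intros n m j Hnm; apply pow_mul_mono; auto using inv_INR_pos, inv_INR_decr, Rlt_le.
  - intros V (x & h & Hx & Hh & ->); destruct (inv_INR_small (Rmin x h)) as [n Hn];
      [now apply Rmin_pos|].
    exists n; intros j; apply pow_mul_mono; auto using inv_INR_pos, Rlt_le;
      apply Rle_trans with (1 := Hn); [apply Rmin_l | apply Rmin_r].
Qed.

Lemma Beurling_MPhi_weight_class (M Phi : nat -> R) (f : R -> C) :
  Beurling_MPhi M Phi f <-> weight_class (weights_MPhi M Phi) f.
Proof.
  split; intros [Hf H]; (split; [exact Hf|]); intros K HK.
  - intros V (h & Hh & ->); now apply (H K HK h).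
  - intros h Hh; apply (H K HK); now exists h.
Qed.

Lemma Beurling_mx_weight_class (L : R -> nat -> R) (f : R -> C) :
  Beurling_mx L f <-> weight_class (weights_mx L) f.
Proof.
  split; intros [Hf H]; (split; [exact Hf|]); intros K HK.
  - intros V (x & h & Hx & Hh & ->); now apply (H K HK x h).
  - intros x h Hx Hh; apply (H K HK); now exists x, h.
Qed.

Lemma seminorms_MPhi_weight_seminorms (M Phi : nat -> R) (p : (R -> C) -> Rbar) :
  seminorms_MPhi M Phi p <-> weight_seminorms (weights_MPhi M Phi) p.
Proof.
  split.
  - intros (K & h & HK & Hh & ->); exists K, (Mc M Phi h); split; [assumption|].
    split; [now exists h | reflexivity].
  - intros (K & V & HK & (h & Hh & ->) & ->); now exists K, h.
Qed.

Lemma seminorms_mx_weight_seminorms (L : R -> nat -> R) (p : (R -> C) -> Rbar) :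
  seminorms_mx L p <-> weight_seminorms (weights_mx L) p.
Proof.
  split.
  - intros (K & x & h & HK & Hx & Hh & ->); exists K, (fun j => h ^ j * L x j).
    split; [assumption|]; split; [now exists x, h | reflexivity].
  - intros (K & V & HK & (x & h & Hx & Hh & ->) & ->); now exists K, x, h.
Qed.

(** * The Beurling case *)

Section SameBeurlingClass.

Variables (M Phi : nat -> R) (L : R -> nat -> R).
Hypothesis M_pos : positive_seq M.
Hypothesis Phi_nonneg : forall j, 0 <= Phi j.
Hypothesis L_matrix : weight_matrix L.
Hypothesis same_class : same_set (Beurling_MPhi M Phi) (Beurling_mx L).

Lemma same_weight_class (f : R -> C) : weight_class (weights_MPhi M Phi) f <-> weight_class (weights_mx L) f.
Proof. rewrite <- Beurling_MPhi_weight_class, <- Beurling_mx_weight_class; apply same_class. Qed.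

Lemma same_Frechet : same_Frechet_space M Phi L.
Proof.
  split; [exact same_class|]; intros U.
  rewrite (seminorm_open_ext _ _ _ _ U (Beurling_MPhi_weight_class M Phi) (seminorms_MPhi_weight_seminorms M Phi)).
  rewrite (seminorm_open_ext _ _ _ _ U (Beurling_mx_weight_class L) (seminorms_mx_weight_seminorms L)).
  apply (same_topology _ _ (basis_MPhi M Phi) (basis_mx L));
    auto using weight_basis_MPhi, weight_basis_mx, same_weight_class.
Qed.

Lemma real_class_mx_dilation (u : R -> R) :
  real_class (basis_mx L) u -> real_class (basis_mx L) (fun t => u (2 * t)).
Proof.
  intros [Hu H]; split; [now apply rsmooth_dilation|].
  (* The index [2 * n + 1] has parameter [1 / (2 * n + 2)], which doubles to exactly [1 / (n + 1)],
     and its interval contains the doubled interval of radius [n]. *)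
  intros n; destruct (H (2 * n + 1)%nat) as [c Hc].
  destruct (weight_basis_mx L L_matrix) as (Hpos & HP & _).
  assert (Hc0 := deriv_bound_nonneg _ _ _ _ (Hpos _ (HP _)) (pos_INR _) Hc).
  exists c; intros j x Hx.
  rewrite Derive_n_dilation, Rabs_mult, (Rabs_pos_eq (2 ^ j)) by (assumption || apply pow_le; lra).
  apply Rle_trans with (2 ^ j * (c * basis_mx L (2 * n + 1) j)).
  - apply Rmult_le_compat_l; [apply pow_le; lra|]; apply Hc.
    rewrite Rabs_mult, (Rabs_pos_eq 2), plus_INR, mult_INR by lra; simpl; lra.
  - replace (2 ^ j * _) with (c * (2 ^ j * basis_mx L (2 * n + 1) j)) by ring.
    apply Rmult_le_compat_l; [assumption|]; unfold basis_mx.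
    rewrite <- Rmult_assoc, <- Rpow_mult_distr.
    apply pow_mul_mono; auto using inv_INR_pos.
    + apply inv_INR_decr; lia.
    + generalize (inv_INR_pos (2 * n + 1)); lra.
    + right; rewrite !S_INR, plus_INR, mult_INR; simpl; field.
      generalize (pos_INR n); split; lra.
Qed.

(* The class is invariant under the dilation by 2, so [2 ^ j u^{(j)}(0) / M_j] is bounded in
   [j] for each [u]; uniform boundedness makes this a continuity estimate. *)
Lemma dilation_estimate :
  exists n C, forall u D, real_class (basis_MPhi M Phi) u -> 0 < D ->
    deriv_bound (basis_MPhi M Phi n) (INR n) u D ->
    forall j, 2 ^ j * Rabs (Derive_n u j 0) <= C * D * M j.
Proof.
  assert (HW := weight_basis_MPhi M Phi M_pos Phi_nonneg).
  assert (HX := weight_basis_mx L L_matrix).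
  assert (HV : positive_seq (fun j => / 2 ^ j * M j)).
  { intros j; apply Rmult_lt_0_compat; [apply Rinv_0_lt_compat, pow_lt; lra | apply M_pos]. }
  assert (HW' := HW); destruct HW' as (Hpos & HP & Hdecr & _).
  destruct (uniform_boundedness (basis_MPhi M Phi) (fun j => / 2 ^ j * M j) 0)
    as (n & C & HC); auto.
  - intros u Hu.
    assert (Hu2 : real_class (basis_MPhi M Phi) (fun t => u (2 * t))).
    { apply (weight_class_real _ _ _ HW), same_weight_class, (weight_class_real _ _ _ HX), real_class_mx_dilation.
      now apply (weight_class_real _ _ _ HX), same_weight_class, (weight_class_real _ _ _ HW). }
    (* At index 0 the parameter is 1 and the interval is the single point 0, so this seminorm
       compares the derivatives at 0 with [M] itself. *)
    destruct (proj2 Hu2 0%nat) as [c Hc]; exists c; intros j x Hx.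
    replace x with 0 by (apply Rabs_le_iff in Hx; lra).
    specialize (Hc j 0); rewrite Rabs_R0 in Hc; specialize (Hc (Rle_refl 0)).
    rewrite Derive_n_dilation, Rmult_0_r, Rabs_mult, (Rabs_pos_eq (2 ^ j)) in Hc
      by (apply Hu || apply pow_le; lra).
    unfold basis_MPhi, Mc in Hc; simpl INR in Hc.
    replace (Rpower (/ 1) (Phi j)) with 1 in Hc
      by (unfold Rpower; rewrite Rinv_1, ln_1, Rmult_0_r, exp_0; reflexivity).
    assert (H2 : 0 < 2 ^ j) by (apply pow_lt; lra).
    apply (Rmult_le_reg_l (2 ^ j)); [assumption|].
    replace (2 ^ j * (c * (/ 2 ^ j * M j))) with (c * (1 * M j)) by (field; lra); exact Hc.
  - exists n, C; intros u D Hu HD Hb j.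
    specialize (HC u D Hu HD Hb j 0); rewrite Rabs_R0 in HC; specialize (HC (Rle_refl 0)).
    assert (H2 : 0 < 2 ^ j) by (apply pow_lt; lra).
    apply (Rmult_le_compat_l (2 ^ j)) in HC; [|lra].
    replace (2 ^ j * (C * D * (/ 2 ^ j * M j))) with (C * D * M j) in HC by (field; lra); exact HC.
Qed.

Lemma Beurling_LimInf :
  (forall c, 0 < c ->
      root_to_infinity (Mc M Phi c) /\
      exists N : nat -> R,
        (exists j0, forall j, (j0 <= j)%nat -> N j = Mc M Phi c j) /\
        positive_seq N /\ log_convex N /\ N 0%nat = 1) ->
  Rbar_lt 0 (LimInf_seq (fun j => Phi j / INR j)).
Proof.
  intros HMc; destruct dilation_estimate as (n & C & HC).
  assert (Hn := inv_INR_pos n).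
  destruct (HMc _ Hn) as (_ & N & (j0 & Hj0) & HN & HNlc & _).
  assert (HWn : positive_seq (basis_MPhi M Phi n)) by now apply Mc_pos.
  (* [N] agrees with the weight only from [j0] on; [c] pays for the finitely many changed terms. *)
  destruct (eventually_le_le_mult N (basis_MPhi M Phi n) j0) as (c & Hc & Hcj); auto.
  { intros j Hj; right; now apply Hj0. }
  apply (LimInf_pos_of_pow_le Phi (2 * (Rabs C + 1) * c) (INR (S n)) j0); auto.
  { generalize (Rabs_pos C); nra. }
  intros j Hj.
  set (mu := N (S j) / N j).
  assert (Hmu : 0 < mu) by (apply Rdiv_lt_0_compat; apply HN).
  assert (Hmuj : 0 < mu ^ j) by now apply pow_lt.
  assert (Hq : 0 < mu ^ j / N j) by (apply Rdiv_lt_0_compat; [assumption | apply HN]).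
  (* The factor 2 comes from [wave_bound]; the rest from the support line of [N] at [j], which gives
     [mu ^ i <= N i * (mu ^ j / N j)]. *)
  set (D := 2 * (c * (mu ^ j / N j))).
  assert (HD : 0 < D) by (unfold D; nra).
  assert (H : 2 ^ j * mu ^ j <= C * D * M j).
  { replace (mu ^ j) with (Rabs (Derive_n (wave mu) j 0)).
    2: { rewrite wave_at_0, Rabs_mult, (proj1 (trig_coef_abs j)), Rabs_pos_eq; lra. }
    apply HC; [|assumption|].
    - split; [apply wave_smooth|]; intros m.
      destruct (pow_le_of_root_to_infinity (basis_MPhi M Phi m) mu) as (d & _ & Hd);
        [now apply Mc_pos | apply HMc, inv_INR_pos | assumption |].
      exists (2 * d); intros i x _; eapply Rle_trans; [apply wave_bound; lra|].
      specialize (Hd i); lra.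
    - intros i x _; eapply Rle_trans; [apply wave_bound; lra|].
      unfold D; rewrite Rmult_assoc; apply Rmult_le_compat_l; [lra|].
      apply Rle_trans with (N i * (mu ^ j / N j)).
      + apply (Rmult_le_reg_l (N j)); [apply HN|].
        replace (N j * (N i * (mu ^ j / N j))) with (N i * mu ^ j)
          by (field; apply Rgt_not_eq, HN).
        now apply log_convex_support.
      + specialize (Hcj i); nra. }
  assert (HNj : N j = Rpower (/ INR (S n)) (Phi j) * M j) by now apply Hj0.
  assert (HR : Rpower (INR (S n)) (Phi j) * Rpower (/ INR (S n)) (Phi j) = 1).
  { rewrite Rpower_mult_distr, Rinv_r by (apply Rgt_not_eq || idtac; try apply lt_0_INR; lia || assumption).
    unfold Rpower; rewrite ln_1, Rmult_0_r; apply exp_0. }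
  assert (HMj := M_pos j); assert (HNjp := HN j).
  set (R1 := Rpower (INR (S n)) (Phi j)) in *; set (R2 := Rpower (/ INR (S n)) (Phi j)) in *.
  assert (HR1 : 0 < R1) by apply exp_pos.
  assert (HR2 : 0 < R2) by apply exp_pos.
  assert (HCabs : C * D * M j <= (Rabs C + 1) * D * M j).
  { apply Rmult_le_compat_r; [lra|]; apply Rmult_le_compat_r; [lra|].
    generalize (Rle_abs C); lra. }
  (* The factor [mu ^ j] in [D] cancels, and [M j / N j] is the power of [n + 1] sought. *)
  apply (Rmult_le_reg_r (mu ^ j)); [assumption|].
  apply Rle_trans with ((Rabs C + 1) * D * M j); [lra|]; right.
  unfold D; rewrite HNj.
  replace R1 with (/ R2); [field; split; lra|].
  apply (Rmult_eq_reg_r R2); [rewrite HR; field|]; lra.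
Qed.

End SameBeurlingClass.

(** * Characteristic functions of log-convex sequences *)

(* [sum_k 2^{-k} N_k mu_k^{-k} wave (mu_k x)] with [mu_k = N_{k+1} / N_k]: by log-convexity
   the j-th derivatives of the summands are at most [2^{1-k} N_j], with equality up to the
   factor 2 at [0] for [k = j]. *)
Fixpoint char_sum (N : nat -> R) (n : nat) (x : R) : R :=
  match n with
  | O => 0
  | S k => 1 * char_sum N k x +
      (1 / 2) ^ k * N k / (N (S k) / N k) ^ k * wave (N (S k) / N k) x
  end.

Lemma char_sum_smooth (N : nat -> R) (n : nat) : rsmooth (char_sum N n).
Proof.
  induction n as [|n IH]; [exact (rsmooth_const 0)|].
  apply (rsmooth_lin 1 _ (char_sum N n) (wave (N (S n) / N n))); [exact IH | apply wave_smooth].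
Qed.

Lemma char_sum_step (N : nat -> R) (k j : nat) (x : R) :
  Derive_n (char_sum N (S k)) j x = Derive_n (char_sum N k) j x +
    (1 / 2) ^ k * N k / (N (S k) / N k) ^ k * Derive_n (wave (N (S k) / N k)) j x.
Proof.
  eapply eq_trans; [apply (Derive_n_lin 1 _ (char_sum N k) (wave (N (S k) / N k)))|].
  - apply char_sum_smooth.
  - apply wave_smooth.
  - now rewrite Rmult_1_l.
Qed.

(** The bounds on the summands add up to [4 * N j]. At 0 the [j]-th derivatives of all summands have
    the sign of the same [trig_coef], so nothing cancels and the summand [k = j] alone gives the
    lower bound. *)
Lemma characteristic_function (N : nat -> R) :
  positive_seq N -> log_convex N ->
  exists u, rsmooth u /\ (forall j x, Rabs (Derive_n u j x) <= 4 * N j) /\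
    forall j, N j <= 2 ^ j * Rabs (Derive_n u j 0).
Proof.
  intros HN Hlc.
  assert (Hmu : forall k, 0 < N (S k) / N k) by (intros; apply Rdiv_lt_0_compat; apply HN).
  assert (Ha : forall k, 0 < (1 / 2) ^ k * N k / (N (S k) / N k) ^ k).
  { intros k; apply Rdiv_lt_0_compat; [|apply pow_lt, Hmu].
    apply Rmult_lt_0_compat; [apply pow_half_pos | apply HN]. }
  assert (Hinc : forall n j x, Rabs (Derive_n (char_sum N (S n)) j x - Derive_n (char_sum N n) j x)
      <= 2 * N j * (1 / 2) ^ n).
  { intros k j x; rewrite char_sum_step.
    replace (_ - _) with ((1 / 2) ^ k * N k / (N (S k) / N k) ^ k * Derive_n (wave (N (S k) / N k)) j x)
      by ring.
    rewrite Rabs_mult, Rabs_pos_eq by apply Rlt_le, Ha.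
    generalize (wave_bound (N (S k) / N k) j x (Rlt_le _ _ (Hmu k))); intros Hw.
    apply Rle_trans with (1 := Rmult_le_compat_l _ _ _ (Rlt_le _ _ (Ha k)) Hw).
    generalize (log_convex_support N j k HN Hlc) (pow_lt _ k (Hmu k)) (pow_half_pos k).
    set (m := (N (S k) / N k)); intros Hsup Hm Hh.
    apply (Rmult_le_reg_r (m ^ k)); [assumption|].
    replace ((1 / 2) ^ k * N k / m ^ k * (2 * m ^ j) * m ^ k)
      with (2 * (1 / 2) ^ k * (N k * m ^ j)) by (field; lra).
    replace (2 * N j * (1 / 2) ^ k * m ^ k) with (2 * (1 / 2) ^ k * (N j * m ^ k)) by ring.
    apply Rmult_le_compat_l; lra. }
  destruct (smooth_limit (char_sum N)) as (u & Hu & Hlim).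
  { apply char_sum_smooth. }
  { intros j r; exists 0%nat, (2 * N j); auto. }
  exists u; split; [assumption|]; split.
  - intros j x.
    apply (is_lim_seq_le (fun n => Rabs (Derive_n (char_sum N n) j x)) (fun _ => 4 * N j)
      (Rbar_abs (Derive_n u j x)) (4 * N j)).
    + intros n.
      (* The tail is taken from stage 0, where the partial sum vanishes. *)
      generalize (geometric_tail (fun n => Derive_n (char_sum N n) j x) (2 * N j) 0
        (fun n _ => Hinc n j x) 0 n (le_n _) (Nat.le_0_l n)); simpl char_sum.
      rewrite Derive_n_zero, Rminus_0_r; simpl; lra.
    + apply is_lim_seq_abs, Hlim.
    + apply is_lim_seq_const.
  - intros j.
    set (p := fst (trig_coef j)).
    (* Since [p] is 1 or -1, multiplying by it turns every increment at 0 into a positive one. *)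
    assert (Hstep : forall n, p * Derive_n (char_sum N (S n)) j 0 = p * Derive_n (char_sum N n) j 0 +
      (1 / 2) ^ n * N n / (N (S n) / N n) ^ n * (N (S n) / N n) ^ j).
    { intros n; rewrite char_sum_step, wave_at_0; fold p.
      replace ((N (S n) / N n) ^ j) with (Rsqr p * (N (S n) / N n) ^ j) at 2.
      - unfold Rsqr; ring.
      - rewrite Rsqr_abs; unfold p; rewrite (proj1 (trig_coef_abs j)); unfold Rsqr; ring. }
    assert (Hinc0 : forall n, 0 <= (1 / 2) ^ n * N n / (N (S n) / N n) ^ n * (N (S n) / N n) ^ j)
      by (intros n; apply Rmult_le_pos; [apply Rlt_le, Ha | apply pow_le, Rlt_le, Hmu]).
    assert (H0 : forall n, 0 <= p * Derive_n (char_sum N n) j 0).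
    { induction n as [|n IH]; [simpl char_sum; rewrite Derive_n_zero; lra|].
      rewrite Hstep; specialize (Hinc0 n); lra. }
    (* The summand [k = j] is first present in [char_sum N (S j)]. *)
    assert (Hlow : forall n, (S j <= n)%nat -> (1 / 2) ^ j * N j <= p * Derive_n (char_sum N n) j 0).
    { intros n Hn; induction Hn as [|n Hn IH]; rewrite Hstep.
      - specialize (H0 j).
        replace ((1 / 2) ^ j * N j / (N (S j) / N j) ^ j * (N (S j) / N j) ^ j)
          with ((1 / 2) ^ j * N j); [lra|].
        generalize (pow_lt _ j (Hmu j)); set (m := (N (S j) / N j) ^ j); intros; field; lra.
      - specialize (Hinc0 n); lra. }
    assert (Hl : (1 / 2) ^ j * N j <= p * Derive_n u j 0).
    { apply (is_lim_seq_le_loc (fun _ => (1 / 2) ^ j * N j)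
        (fun n => p * Derive_n (char_sum N n) j 0) ((1 / 2) ^ j * N j) (p * Derive_n u j 0)).
      - exists (S j); apply Hlow.
      - apply is_lim_seq_const.
      - apply (is_lim_seq_scal_l _ p (Derive_n u j 0)), Hlim. }
    assert (Habs : (1 / 2) ^ j * N j <= Rabs (Derive_n u j 0)).
    { apply Rle_trans with (1 := Hl), Rle_trans with (1 := Rle_abs _).
      rewrite Rabs_mult; unfold p; rewrite (proj1 (trig_coef_abs j)); lra. }
    apply (Rmult_le_compat_l (2 ^ j)) in Habs; [|apply pow_le; lra].
    rewrite <- Rmult_assoc, <- Rpow_mult_distr in Habs.
    replace (2 * (1 / 2)) with 1 in Habs by lra; rewrite pow1 in Habs; lra.
Qed.

(** * The Roumieu case *)

Lemma real_smooth (u : R -> R) : rsmooth u <-> smooth (fun t => RtoC (u t)).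
Proof.
  split; intros H j x; [|exact (proj1 (H j x))].
  split; [exact (H j x) | exact (rsmooth_const 0 j x)].
Qed.

Lemma Cmod_CDerive_n_real (u : R -> R) (j : nat) (x : R) :
  Cmod (CDerive_n (fun t => RtoC (u t)) j x) = Rabs (Derive_n u j x).
Proof.
  unfold CDerive_n; simpl; rewrite Derive_n_zero; apply Cmod_R.
Qed.

Lemma Roumieu_mx_dilation (L : R -> nat -> R) (u : R -> R) (a : R) :
  weight_matrix L -> 0 < a ->
  Roumieu_mx L (fun t => RtoC (u t)) -> Roumieu_mx L (fun t => RtoC (u (a * t))).
Proof.
  intros [HLpos _] Ha [Hu H]; apply real_smooth in Hu.
  split; [now apply (real_smooth (fun t => u (a * t))), rsmooth_dilation|].
  intros K HK; destruct (compact_in_interval K HK) as (r & _ & Hr).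
  (* The interval is enlarged by [a] to contain the dilated [K]; the factor [a ^ j] of the
     derivative is absorbed by replacing [h] with [a * h]. *)
  destruct (H _ (compact_P3 (- (a * r)) (a * r))) as (x & h & Hx & Hh & Hn).
  assert (Hpos : forall g, 0 < g -> positive_seq (fun j => g ^ j * L x j))
    by (intros g Hg j; apply Rmult_lt_0_compat; [now apply pow_lt | now apply HLpos]).
  apply sup_norm_finite in Hn; [|now apply Hpos].
  destruct Hn as (d & Hd & Hdj).
  exists x, (a * h); split; [assumption|]; split; [now apply Rmult_lt_0_compat|].
  apply sup_norm_finite; [apply Hpos; now apply Rmult_lt_0_compat|].
  exists d; split; [assumption|]; intros j t Ht.
  rewrite (Cmod_CDerive_n_real (fun t => u (a * t))), Derive_n_dilation, Rabs_mult,
    (Rabs_pos_eq (a ^ j)) by (assumption || apply pow_le; lra).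
  specialize (Hdj j (a * t)); rewrite Cmod_CDerive_n_real in Hdj.
  rewrite Rpow_mult_distr.
  replace (d * (a ^ j * h ^ j * L x j)) with (a ^ j * (d * (h ^ j * L x j))) by ring.
  apply Rmult_le_compat_l; [apply pow_le; lra|]; apply Hdj, Rabs_le_iff.
  rewrite Rabs_mult, (Rabs_pos_eq a) by lra; apply Rmult_le_compat_l; [lra | now apply Hr].
Qed.

Lemma Roumieu_LimInf (M Phi : nat -> R) (L : R -> nat -> R) (c : R) :
  positive_seq M -> (forall j, 0 <= Phi j) -> 0 < c -> log_convex (Mc M Phi c) ->
  weight_matrix L -> same_set (Roumieu_MPhi M Phi) (Roumieu_mx L) ->
  Rbar_lt 0 (LimInf_seq (fun j => Phi j / INR j)).
Proof.
  intros HM HPhi Hc Hlc HL Hsame.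
  destruct (characteristic_function _ (Mc_pos M Phi c HM) Hlc) as (u & Hu & Hup & Hlow).
  assert (Hcls : Roumieu_MPhi M Phi (fun t => RtoC (u t))).
  { split; [now apply real_smooth|]; intros K HK; exists c; split; [assumption|].
    apply sup_norm_finite; [now apply Mc_pos|].
    exists 4; split; [lra|]; intros j x _; rewrite Cmod_CDerive_n_real; apply Hup. }
  (* The function is moved to the matrix class, dilated there and moved back. Of the factor [4 ^ j],
     one [2 ^ j] compensates the loss in the lower bound at 0 and the other remains. *)
  apply Hsame, (Roumieu_mx_dilation L u 4 HL), Hsame in Hcls; [|lra].
  destruct Hcls as [_ Hcls].
  destruct (Hcls _ (compact_P3 0 0)) as (h & Hh & Hn).
  apply sup_norm_finite in Hn; [|now apply Mc_pos].
  destruct Hn as (d & Hd & Hdj).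
  (* The base [h / c] compares the weight with parameter [h] to the log-convex one with parameter
     [c]; [d + 1] makes the constant positive. *)
  apply (LimInf_pos_of_pow_le Phi (d + 1) (h / c) 0); [assumption | lra|]; intros j _.
  specialize (Hdj j 0 (conj (Rle_refl 0) (Rle_refl 0))); specialize (Hlow j).
  rewrite (Cmod_CDerive_n_real (fun t => u (4 * t))), Derive_n_dilation, Rmult_0_r, Rabs_mult,
    (Rabs_pos_eq (4 ^ j)) in Hdj by (assumption || apply pow_le; lra).
  replace (4 ^ j) with (2 ^ j * 2 ^ j) in Hdj by (rewrite <- Rpow_mult_distr; f_equal; lra).
  assert (HR : Rpower h (Phi j) = Rpower (h / c) (Phi j) * Rpower c (Phi j)).
  { rewrite Rpower_mult_distr by (try apply Rdiv_lt_0_compat; assumption).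
    f_equal; field; lra. }
  unfold Mc in Hdj, Hlow; rewrite HR in Hdj.
  assert (Hq : 0 < Rpower c (Phi j) * M j) by now apply Mc_pos.
  assert (Hp : 0 < Rpower (h / c) (Phi j)) by apply exp_pos.
  assert (H2 : 0 < 2 ^ j) by (apply pow_lt; lra).
  apply (Rmult_le_reg_r (Rpower c (Phi j) * M j)); [assumption|].
  apply Rle_trans with (2 ^ j * (2 ^ j * Rabs (Derive_n u j 0))).
  - apply Rmult_le_compat_l; lra.
  - apply Rle_trans with (d * Rpower (h / c) (Phi j) * (Rpower c (Phi j) * M j)); [lra|].
    apply Rmult_le_compat_r; [lra|]; apply Rmult_le_compat_r; lra.
Qed.

Theorem theorem4p7 (M Phi : nat -> R)
    (hM : positive_seq M) (hPhi : forall j, 0 <= Phi j) :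
  ((exists c, 1 <= c /\ log_convex (Mc M Phi c) /\ normalized (Mc M Phi c)) ->
   forall L : R -> nat -> R,
     weight_matrix L ->
     (forall x, 0 < x -> normalized (L x) /\ log_convex (L x)) ->
     same_set (Roumieu_MPhi M Phi) (Roumieu_mx L) ->
     Rbar_lt 0 (LimInf_seq (fun j => Phi j / INR j)))
  /\
  ((forall c, 0 < c ->
      root_to_infinity (Mc M Phi c) /\
      exists N : nat -> R,
        (exists j0, forall j, (j0 <= j)%nat -> N j = Mc M Phi c j) /\
        positive_seq N /\ log_convex N /\ N 0%nat = 1) ->
   forall L : R -> nat -> R,
     standard_log_convex L ->
     same_set (Beurling_MPhi M Phi) (Beurling_mx L) ->
     same_Frechet_space M Phi L /\
     Rbar_lt 0 (LimInf_seq (fun j => Phi j / INR j))).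
Proof.
  split.
  - intros (c & Hc & Hlc & _) L HL _ Hsame.
    apply (Roumieu_LimInf M Phi L c); auto; lra.
  - intros HMc L [HL _] Hsame; split.
    + now apply same_Frechet.
    + now apply (Beurling_LimInf M Phi L).
Qed.
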